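(* Let $\mathfrak{osp}(1,2)$ be the complex Lie superalgebra of dimension $3|2$ with basis $\{e_1,e_2,e_3\mid e_4,e_5\}$ ($e_1,e_2,e_3$ even, $e_4,e_5$ odd) and nontrivial brackets \begin{align*} &[e_1,e_2]=e_3,\ [e_1,e_3]=-2e_1,\ [e_2,e_3]=2e_2,\ [e_1,e_5]=-e_4,\ [e_2,e_4]=-e_5,\\ &[e_3,e_4]=e_4,\ [e_3,e_5]=-e_5,\ [e_4,e_4]=\tfrac12 e_1,\ [e_4,e_5]=\tfrac14 e_3,\ [e_5,e_5]=-\tfrac12 e_2. \end{align*} Then $\mathfrak{osp}(1,2)$ only has trivial metric deformations, i.e. every metric deformation of $\mathfrak{osp}(1,2)$ is trivial.
   Context: All Lie superalgebras are over $\mathbb{C}$. Brackets of basis elements that are not listed are zero or determined by $[y,x]=-(-1)^{|x||y|}[x,y]$. A metric Lie superalgebra is a Lie superalgebra together with an even, non-degenerate, supersymmetric bilinear form $B$ that is invariant: $B([x,y],z)=B(x,[y,z])$. A formal 1-parameter deformation of a Lie superalgebra $(\mathfrak g,[\ ,\ ])$ is a $\mathbb{C}[[t]]$-bilinear Lie superalgebra structure on $\mathfrak g[[t]]=\mathfrak g\otimes_{\mathbb C}\mathbb{C}[[t]]$ of the form $[\ ,\ ]_t=[\ ,\ ]+\sum_{i\ge1}t^i\phi_i$, each $\phi_i:\mathfrak g\times\mathfrak g\to\mathfrak g$ being an even super-skew-symmetric bilinear map. Two such deformations $[\ ,\ ]_t,[\ ,\ ]'_t$ are equivalent if there is $\widehat\psi_t=\mathrm{id}+\psi_1t+\psi_2t^2+\cdots$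 with even linear $\psi_i:\mathfrak g\to\mathfrak g$ and $\widehat\psi_t([x,y]_t)=[\widehat\psi_t(x),\widehat\psi_t(y)]'_t$ for all $x,y\in\mathfrak g$. A deformation is trivial if it is equivalent to the original bracket. A metric deformation is a formal 1-parameter deformation that defines a metric Lie superalgebra, i.e. $(\mathfrak g[[t]],[\ ,\ ]_t)$ admits an even, supersymmetric, invariant $\mathbb{C}[[t]]$-bilinear form that is non-degenerate over $\mathbb{C}[[t]]$ (induces an isomorphism with the dual module). *)

(* Defs.v *)
From HB Require Import structures.
From mathcomp Require Import all_boot all_order all_algebra ring.
From mathcomp Require Import boolp.

Set Implicit Arguments.
Unset Strict Implicit.
Unset Printing Implicit Defensive.

Import Order.TTheory GRing.Theory Num.Theory.
Local Open Scope ring_scope.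

(** * Formal power series *)

(** [series V] is V[[t]]; for a module V that is free of finite rank over K it
    is V \otimes_K K[[t]]. *)
Record series (V : Type) : Type := Series { coefs :> nat -> V }.

Lemma seriesP (V : Type) (f g : series V) : (forall n, f n = g n) -> f = g.
Proof. by case: f g => [f] [g] /= /funext ->. Qed.

HB.instance Definition _ (V : Type) := gen_eqMixin (series V).
HB.instance Definition _ (V : Type) := gen_choiceMixin (series V).

Definition series0 (V : zmodType) : series V := Series (fun=> 0).
Definition series_opp (V : zmodType) (f : series V) : series V :=
  Series (fun n => - f n).
Definition series_add (V : zmodType) (f g : series V) : series V :=
  Series (fun n => f n + g n).

Fact series_addA (V : zmodType) : associative (@series_add V).
Proof. by move=> f g h; apply: seriesP => n /=; rewrite addrA. Qed.
Fact series_addC (V : zmodType) : commutative (@series_add V).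
Proof. by move=> f g; apply: seriesP => n /=; rewrite addrC. Qed.
Fact series_add0 (V : zmodType) : left_id (@series0 V) (@series_add V).
Proof. by move=> f; apply: seriesP => n /=; rewrite add0r. Qed.
Fact series_addN (V : zmodType) :
  left_inverse (@series0 V) (@series_opp V) (@series_add V).
Proof. by move=> f; apply: seriesP => n /=; rewrite addNr. Qed.

HB.instance Definition _ (V : zmodType) := GRing.isZmodule.Build (series V)
  (@series_addA V) (@series_addC V) (@series_add0 V) (@series_addN V).

Lemma series0E (V : zmodType) n : (0 : series V) n = 0. Proof. by []. Qed.
Lemma seriesDE (V : zmodType) (f g : series V) n : (f + g) n = f n + g n.
Proof. by []. Qed.
Lemma seriesNE (V : zmodType) (f : series V) n : (- f) n = - f n.
Proof. by []. Qed.

Definition series_const (V : zmodType) (v : V) : series V :=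
  Series (fun n => if n is 0%N then v else 0).

Lemma sum_triangle (V : zmodType) (F : nat -> nat -> nat -> V) n :
  \sum_(i < n.+1) \sum_(j < (n - i).+1) F i j (n - i - j)%N =
  \sum_(k < n.+1) \sum_(j < k.+1) F j (k - j)%N (n - k)%N.
Proof.
elim: n F => [|n IHn] F; first by rewrite !big_ord1.
rewrite big_ord_recl.
under [X in _ + X]eq_bigr => i _ do rewrite lift0 subSS.
rewrite (IHn (fun i => F i.+1)).
under [RHS]eq_bigr => k _ do rewrite big_ord_recl subn0.
rewrite big_split /= subn0; congr (_ + _).
rewrite [RHS]big_ord_recl big_ord0 add0r; apply: eq_bigr => k _.
by rewrite lift0 subSS; apply: eq_bigr => j _; rewrite /bump subSS.
Qed.

Definition series_mul (K : comNzRingType) (f g : series K) : series K :=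
  Series (fun n => \sum_(i < n.+1) f i * g (n - i)%N).

Fact series_mulC (K : comNzRingType) : commutative (@series_mul K).
Proof.
move=> f g; apply: seriesP => n /=; rewrite (reindex_inj rev_ord_inj) /=.
apply: eq_bigr => i _; rewrite subSS mulrC subKn //.
by rewrite -ltnS.
Qed.

Definition series_scale (K : comNzRingType) (V : lmodType K)
    (f : series K) (v : series V) : series V :=
  Series (fun n => \sum_(i < n.+1) f i *: v (n - i)%N).

Fact series_scaleA (K : comNzRingType) (V : lmodType K)
    (f g : series K) (v : series V) :
  series_scale f (series_scale g v) = series_scale (series_mul f g) v.
Proof.
apply: seriesP => n /=.
under eq_bigr => i _ do rewrite scaler_sumr.
rewrite (sum_triangle (fun i j k => f i *: (g j *: v k))).
apply: eq_bigr => k _; rewrite scaler_suml.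
by apply: eq_bigr => j _; rewrite scalerA.
Qed.

Fact series_scale1 (K : comNzRingType) (V : lmodType K) :
  left_id (series_const (1 : K)) (@series_scale K V).
Proof.
move=> v; apply: seriesP => n /=.
rewrite big_ord_recl /= scale1r subn0 big1 ?addr0 // => i _.
by rewrite scale0r.
Qed.

Fact series_scaleDr (K : comNzRingType) (V : lmodType K) :
  right_distributive (@series_scale K V) +%R.
Proof.
move=> f u v; apply: seriesP => n /=; rewrite -big_split /=.
by apply: eq_bigr => i _; rewrite scalerDr.
Qed.

Fact series_scaleDl (K : comNzRingType) (V : lmodType K) (v : series V) :
  {morph (@series_scale K V)^~ v : f g / f + g}.
Proof.
move=> f g; apply: seriesP => n /=; rewrite -big_split /=.
by apply: eq_bigr => i _; rewrite scalerDl.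
Qed.

Fact series_mulA (K : comNzRingType) : associative (@series_mul K).
Proof. by move=> f g h; exact: (@series_scaleA K K^o). Qed.
Fact series_mul1 (K : comNzRingType) :
  left_id (series_const (1 : K)) (@series_mul K).
Proof. exact: (@series_scale1 K K^o). Qed.
Fact series_mulDl (K : comNzRingType) :
  left_distributive (@series_mul K) +%R.
Proof. by move=> f g h; exact: (@series_scaleDl K K^o). Qed.
Fact series_oner_neq0 (K : comNzRingType) : series_const (1 : K) != 0.
Proof.
by apply/eqP => /(congr1 (fun f : series K => f 0%N)) /eqP; rewrite oner_eq0.
Qed.

HB.instance Definition _ (K : comNzRingType) :=
  GRing.Zmodule_isComNzRing.Build (series K)
    (@series_mulA K) (@series_mulC K) (@series_mul1 K) (@series_mulDl K)
    (@series_oner_neq0 K).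

HB.instance Definition _ (K : comNzRingType) (V : lmodType K) :=
  GRing.Zmodule_isLmodule.Build (series K) (series V)
    (@series_scaleA K V) (@series_scale1 K V)
    (@series_scaleDr K V) (@series_scaleDl K V).

Lemma seriesME (K : comNzRingType) (f g : series K) n :
  (f * g) n = \sum_(i < n.+1) f i * g (n - i)%N.
Proof. by []. Qed.
Lemma seriesZE (K : comNzRingType) (V : lmodType K) (f : series K)
    (v : series V) n :
  (f *: v) n = \sum_(i < n.+1) f i *: v (n - i)%N.
Proof. by []. Qed.

(** The K[[t]]-linear map \sum_i t^i psi_i, for K-linear psi_i. *)
Definition series_map (V W : zmodType) (psi : nat -> V -> W) (x : series V) :
    series W :=
  Series (fun n => \sum_(i < n.+1) psi i (x (n - i)%N)).

(** The K[[t]]-bilinear map \sum_i t^i phi_i, for K-bilinear phi_i. *)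
Definition series_map2 (U V W : zmodType) (phi : nat -> U -> V -> W)
    (x : series U) (y : series V) : series W :=
  Series (fun n =>
    \sum_(i < n.+1) \sum_(j < (n - i).+1) phi i (x j) (y (n - i - j)%N)).

(** * Lie superalgebras *)

(** Z/2-graded modules; [homog p x] says that x is homogeneous of parity p
    ([false] is even, [true] is odd). *)
Record superspace (K : comNzRingType) := Superspace {
  super_mod :> lmodType K;
  homog : bool -> super_mod -> Prop;
  homog0 : forall p, homog p 0;
  homog_lin : forall p (a : K) x y,
    homog p x -> homog p y -> homog p (a *: x + y);
  homog_disj : forall x, homog false x -> homog true x -> x = 0;
  homog_decomp : forall x, exists x0 x1,
    [/\ homog false x0, homog true x1 & x = x0 + x1]
}.

Arguments homog {K s} p x.

Definition bilinear_map (K : comNzRingType) (U V W : lmodType K)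
    (f : U -> V -> W) : Prop :=
  (forall x, linear (f x)) /\ (forall y, linear (f^~ y)).

Definition even_map (K : comNzRingType) (V W : superspace K)
    (f : V -> W) : Prop :=
  forall p x, homog p x -> homog p (f x).

Definition even_map2 (K : comNzRingType) (V : superspace K)
    (f : V -> V -> V) : Prop :=
  forall p q x y, homog p x -> homog q y -> homog (p (+) q) (f x y).

Definition super_skew (K : comNzRingType) (V : superspace K)
    (f : V -> V -> V) : Prop :=
  forall p q x y, homog p x -> homog q y ->
    f y x = - ((-1) ^+ (p && q) *: f x y).

Definition super_jacobi (K : comNzRingType) (V : superspace K)
    (f : V -> V -> V) : Prop :=
  forall p q x y z, homog p x -> homog q y ->
    f x (f y z) = f (f x y) z + (-1) ^+ (p && q) *: f y (f x z).

(** These axioms are the usual ones when 6 is invertible in K, as it is in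
    the complex numbers and in the power series over them. *)
Definition lie_superbracket (K : comNzRingType) (V : superspace K)
    (f : V -> V -> V) : Prop :=
  [/\ bilinear_map f, even_map2 f, super_skew f & super_jacobi f].

Record lieSuperalgebra (K : comNzRingType) := LieSuperalgebra {
  lie_space :> superspace K;
  bracket : lie_space -> lie_space -> lie_space;
  bracketP : lie_superbracket bracket
}.

Arguments bracket {K} l x y.

(** The base ring is purely even, so an even form vanishes on homogeneous
    elements of distinct parities. *)
Definition even_form (K : comNzRingType) (V : superspace K)
    (B : V -> V -> K) : Prop :=
  forall p q x y, homog p x -> homog q y -> p != q -> B x y = 0.

Definition supersymmetric (K : comNzRingType) (V : superspace K)
    (B : V -> V -> K) : Prop :=
  forall p q x y, homog p x -> homog q y ->
    B x y = (-1) ^+ (p && q) * B y x.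

Definition invariant_form (K : comNzRingType) (V : superspace K)
    (f : V -> V -> V) (B : V -> V -> K) : Prop :=
  forall x y z, B (f x y) z = B x (f y z).

(** x |-> B x is a bijection from V onto its dual module. *)
Definition nondegenerate (K : comNzRingType) (V : lmodType K)
    (B : V -> V -> K) : Prop :=
  forall h : V -> K, scalar h -> exists! x, forall y, B x y = h y.

Definition metric_form (K : comNzRingType) (V : superspace K)
    (f : V -> V -> V) (B : V -> V -> K) : Prop :=
  ((forall x, scalar (B x)) /\ (forall y, scalar (B^~ y))) /\
  [/\ even_form B, supersymmetric B, invariant_form f B & nondegenerate B].

(** * Deformations *)

Fact series_homog0 (K : comNzRingType) (V : superspace K) p n :
  homog p ((0 : series V) n).
Proof. exact: homog0. Qed.

Fact series_homog_lin (K : comNzRingType) (V : superspace K) p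
    (a : series K) (x y : series V) :
  (forall n, homog p (x n)) -> (forall n, homog p (y n)) ->
  forall n, homog p ((a *: x + y) n).
Proof.
move=> hx hy n; rewrite seriesDE seriesZE.
apply: (big_ind (fun u => homog p (u + y n))) => [|u v hu hv|i _].
- by rewrite add0r.
- rewrite -[u + v + _](_ : 1 *: (u + y n) + (v + y n + -1 *: y n) = _).
    apply: homog_lin => //; rewrite addrC; exact: homog_lin.
  by rewrite scale1r scaleN1r addrK addrAC.
- exact: homog_lin.
Qed.

Fact series_homog_disj (K : comNzRingType) (V : superspace K) (x : series V) :
  (forall n, homog false (x n)) -> (forall n, homog true (x n)) -> x = 0.
Proof. by move=> h0 h1; apply: seriesP => n; exact: homog_disj. Qed.

Fact series_homog_decomp (K : comNzRingType) (V : superspace K)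
    (x : series V) :
  exists x0 x1 : series V, [/\ forall n, homog false (x0 n),
    forall n, homog true (x1 n) & x = x0 + x1].
Proof.
have /choice[u uP] : forall n, exists u : V * V,
    [/\ homog false u.1, homog true u.2 & x n = u.1 + u.2].
  by move=> n; have [a [b ?]] := homog_decomp (x n); exists (a, b).
exists (Series (fun n => (u n).1)), (Series (fun n => (u n).2)).
by split=> [n|n|]; [| |apply: seriesP => n]; have [] := uP n.
Qed.

Definition series_super (K : comNzRingType) (V : superspace K) :
    superspace (series K) :=
  @Superspace (series K) (series V)
    (fun p x => forall n, homog p (x n))
    (@series_homog0 K V) (@series_homog_lin K V)
    (@series_homog_disj K V) (@series_homog_decomp K V).

(** [phi] stands for \sum_i t^i phi_i, with phi_0 the original bracket. *)
Definition deformation (K : comNzRingType) (g : lieSuperalgebra K)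
    (phi : nat -> g -> g -> g) : Prop :=
  [/\ phi 0%N = bracket g,
      forall i, [/\ bilinear_map (phi i), even_map2 (phi i)
                  & super_skew (phi i)]
    & lie_superbracket (V := series_super g) (series_map2 phi)].

Definition original_bracket (K : comNzRingType) (g : lieSuperalgebra K)
    (i : nat) : g -> g -> g :=
  if i is 0%N then bracket g else fun _ _ => 0.

Definition equivalent (K : comNzRingType) (g : lieSuperalgebra K)
    (phi phi' : nat -> g -> g -> g) : Prop :=
  exists psi : nat -> g -> g,
    [/\ psi 0%N = id,
        forall i, linear (psi i) /\ even_map (psi i)
      & forall x y : g,
          let cx := series_const x in let cy := series_const y in
          series_map psi (series_map2 phi cx cy) =
          series_map2 phi' (series_map psi cx) (series_map psi cy)].

Definition trivial_deformation (K : comNzRingType) (g : lieSuperalgebra K)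
    (phi : nat -> g -> g -> g) : Prop :=
  equivalent phi (@original_bracket K g).

(** The form lives over K[[t]] and is not required to extend a given form. *)
Definition metric_deformation (K : comNzRingType) (g : lieSuperalgebra K)
    (phi : nat -> g -> g -> g) : Prop :=
  deformation phi /\
  exists B : series_super g -> series_super g -> series K,
    metric_form (V := series_super g) (series_map2 phi) B.

(** * The Lie superalgebra osp(1,2) *)

(** The basis vectors are numbered from 1 to 5, while coordinates are indexed
    by 'I_5: coordinate j is the coefficient of [osp_e _ j.+1]. *)
Definition osp_e (F : numFieldType) (k : nat) : 'rV[F]_5 :=
  \row_(j < 5) (j.+1 == k)%:R.

Definition osp_odd (k : nat) : bool := (3 < k)%N.

Definition osp_homog (F : numFieldType) (p : bool) (x : 'rV[F]_5) : Prop :=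
  forall j : 'I_5, osp_odd j.+1 != p -> x 0 j = 0.

Definition osp_listed (F : numFieldType) (i j : nat) : 'rV[F]_5 :=
  let e1 := osp_e F 1 in let e2 := osp_e F 2 in let e3 := osp_e F 3 in
  let e4 := osp_e F 4 in let e5 := osp_e F 5 in
  match i, j with
  | 1%N, 2%N => e3
  | 1%N, 3%N => - 2 *: e1
  | 2%N, 3%N => 2 *: e2
  | 1%N, 5%N => - e4
  | 2%N, 4%N => - e5
  | 3%N, 4%N => e4
  | 3%N, 5%N => - e5
  | 4%N, 4%N => 2^-1 *: e1
  | 4%N, 5%N => 4^-1 *: e3
  | 5%N, 5%N => - 2^-1 *: e2
  | _, _ => 0
  end.

Definition osp_basis_bracket (F : numFieldType) (i j : nat) : 'rV[F]_5 :=
  if (i <= j)%N then osp_listed F i j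
  else - ((-1) ^+ (osp_odd i && osp_odd j) *: osp_listed F j i).

Definition osp_bracket (F : numFieldType) (x y : 'rV[F]_5) : 'rV[F]_5 :=
  \sum_(i < 5) \sum_(j < 5)
    (x 0 i * y 0 j) *: osp_basis_bracket F i.+1 j.+1.

Fact osp_homog0 (F : numFieldType) p : osp_homog p (0 : 'rV[F]_5).
Proof. by move=> j _; rewrite mxE. Qed.

Fact osp_homog_lin (F : numFieldType) p (a : F) (x y : 'rV[F]_5) :
  osp_homog p x -> osp_homog p y -> osp_homog p (a *: x + y).
Proof. by move=> hx hy j hj; rewrite !mxE hx // hy // mulr0 addr0. Qed.

Fact osp_homog_disj (F : numFieldType) (x : 'rV[F]_5) :
  osp_homog false x -> osp_homog true x -> x = 0.
Proof.
move=> h0 h1; apply/rowP => j; rewrite mxE.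
by case: (boolP (osp_odd j.+1)) => hj; [apply: h0|apply: h1]; move: hj; case: osp_odd.
Qed.

Fact osp_homog_decomp (F : numFieldType) (x : 'rV[F]_5) :
  exists x0 x1, [/\ osp_homog false x0, osp_homog true x1 & x = x0 + x1].
Proof.
exists (\row_j (if osp_odd j.+1 then 0 else x 0 j)).
exists (\row_j (if osp_odd j.+1 then x 0 j else 0)).
split=> [j|j|]; [by rewrite mxE; case: ifP| by rewrite mxE; case: ifP|].
by apply/rowP => j; rewrite !mxE; case: ifP; rewrite ?add0r ?addr0.
Qed.

Definition osp_super (F : numFieldType) : superspace F :=
  @Superspace F 'rV[F]_5 (@osp_homog F) (@osp_homog0 F) (@osp_homog_lin F)
    (@osp_homog_disj F) (@osp_homog_decomp F).


Lemma osp_bracketE (F : numFieldType) (x y : 'rV[F]_5) (k : 'I_5) :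
  let a (i : nat) := x 0 (inord i.-1) in
  let b (i : nat) := y 0 (inord i.-1) in
  osp_bracket x y 0 k = nth 0
    [:: 2 * (a 3 * b 1 - a 1 * b 3) + a 4 * b 4 / 2;
        2 * (a 2 * b 3 - a 3 * b 2) - a 5 * b 5 / 2;
        a 1 * b 2 - a 2 * b 1 + (a 4 * b 5 + a 5 * b 4) / 4;
        a 5 * b 1 - a 1 * b 5 + a 3 * b 4 - a 4 * b 3;
        a 4 * b 2 - a 2 * b 4 + a 5 * b 3 - a 3 * b 5] k.
Proof.
move=> a b; rewrite /osp_bracket.
have E (G : 'I_5 -> 'rV[F]_5) : \sum_i G i =
    G (inord 0) + G (inord 1) + G (inord 2) + G (inord 3) + G (inord 4).
  rewrite !big_ord_recl big_ord0 addr0 !addrA.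
  by do !congr (_ + _); congr (G _); apply: val_inj; rewrite /= inordK.
rewrite !E !inordK // -[inord 0]/(inord 1.-1) -[inord 1]/(inord 2.-1).
rewrite -[inord 2]/(inord 3.-1) -[inord 3]/(inord 4.-1).
rewrite -[inord 4]/(inord 5.-1) -!/(a _) -!/(b _).
move: (a) (b) => {}a {}b; rewrite /osp_basis_bracket /= /osp_listed.
rewrite !expr0 !expr1.
by case: k => [[|[|[|[|[|//]]]]] ?]; rewrite !mxE /=; field.
Qed.

Fact osp_bilinear (F : numFieldType) : bilinear_map (@osp_bracket F).
Proof.
split=> x c u v; apply/rowP => k; rewrite !mxE !osp_bracketE.
  by case: k => [[|[|[|[|[|//]]]]] ?]; rewrite !mxE /=; field.
by case: k => [[|[|[|[|[|//]]]]] ?]; rewrite !mxE /=; field.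
Qed.

Lemma osp_homog_coord (F : numFieldType) p (x : 'rV[F]_5) :
  osp_homog p x ->
  if p then [/\ x 0 (inord 0) = 0, x 0 (inord 1) = 0 & x 0 (inord 2) = 0]
  else x 0 (inord 3) = 0 /\ x 0 (inord 4) = 0.
Proof. by case: p => hx; split; apply: hx; rewrite inordK. Qed.

Fact osp_lie (F : numFieldType) :
  lie_superbracket (V := osp_super F) (@osp_bracket F).
Proof.
split; first exact: osp_bilinear.
- move=> p q x y /osp_homog_coord hx /osp_homog_coord hy k.
  rewrite osp_bracketE /=.
  move: p q hx hy => [] [] => [[x0 x1 x2]|[x0 x1 x2]|[x3 x4]|[x3 x4]]
    => [[y0 y1 y2]|[y3 y4]|[y0 y1 y2]|[y3 y4]].
  + rewrite !(x0, x1, x2, y0, y1, y2).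
    by case: k => [[|[|[|[|[|//]]]]] ?] //= _; ring.
  + rewrite !(x0, x1, x2, y3, y4).
    by case: k => [[|[|[|[|[|//]]]]] ?] //= _; ring.
  + rewrite !(x3, x4, y0, y1, y2).
    by case: k => [[|[|[|[|[|//]]]]] ?] //= _; ring.
  + rewrite !(x3, x4, y3, y4).
    by case: k => [[|[|[|[|[|//]]]]] ?] //= _; ring.
- move=> p q x y /osp_homog_coord hx /osp_homog_coord hy.
  apply/rowP => k; rewrite !mxE !osp_bracketE /=.
  move: p q hx hy => [] [] => [[x0 x1 x2]|[x0 x1 x2]|[x3 x4]|[x3 x4]]
    => [[y0 y1 y2]|[y3 y4]|[y0 y1 y2]|[y3 y4]].
  + rewrite !(x0, x1, x2, y0, y1, y2).
    by case: k => [[|[|[|[|[|//]]]]] ?] /=; field.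
  + rewrite !(x0, x1, x2, y3, y4).
    by case: k => [[|[|[|[|[|//]]]]] ?] /=; field.
  + rewrite !(x3, x4, y0, y1, y2).
    by case: k => [[|[|[|[|[|//]]]]] ?] /=; field.
  + rewrite !(x3, x4, y3, y4).
    by case: k => [[|[|[|[|[|//]]]]] ?] /=; field.
- move=> p q x y z /osp_homog_coord hx /osp_homog_coord hy.
  apply/rowP => k; rewrite !mxE !osp_bracketE !inordK //=.
  move: p q hx hy => [] [] => [[x0 x1 x2]|[x0 x1 x2]|[x3 x4]|[x3 x4]]
    => [[y0 y1 y2]|[y3 y4]|[y0 y1 y2]|[y3 y4]].
  + rewrite !(x0, x1, x2, y0, y1, y2).
    by case: k => [[|[|[|[|[|//]]]]] ?] /=; field.
  + rewrite !(x0, x1, x2, y3, y4).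
    by case: k => [[|[|[|[|[|//]]]]] ?] /=; field.
  + rewrite !(x3, x4, y0, y1, y2).
    by case: k => [[|[|[|[|[|//]]]]] ?] /=; field.
  + rewrite !(x3, x4, y3, y4).
    by case: k => [[|[|[|[|[|//]]]]] ?] /=; field.
Qed.

Definition osp12 (F : numFieldType) : lieSuperalgebra F :=
  LieSuperalgebra (@osp_lie F).

(* Main.v *)
Require Import Defs.
From mathcomp Require Import all_boot all_order all_algebra.
From mathcomp Require Import reals complex.
From mathcomp Require Import ring boolp.

(** Let [,]_t be a deformation of g and suppose that psi = id + t psi_1 + ...
    intertwines [,]_t with the original bracket below order n. The coefficient
    of t^n in the defect [psi x, psi y] - psi [x, y]_t is then an even
    2-cocycle of g with values in the adjoint module; if it is the coboundary
    of eta, replacing psi_n by psi_n + eta kills it. So the deformation is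
    trivial as soon as every even 2-cocycle is a coboundary, metric or not.

    For osp(1,2), the even part is spanned by the brackets [e4,e4], [e4,e5],
    [e5,e5], so a coboundary can be subtracted from a cocycle to make it vanish
    on pairs of odd vectors. The cocycle condition on three odd vectors leaves
    four parameters, the coordinates of chi(e1,e5) and chi(e2,e4); the condition
    on one even and two odd vectors leaves one, which is removed by the
    coboundary of the map acting as c on the odd part and as 2c on the even
    part. *)

Set Implicit Arguments.
Unset Strict Implicit.
Unset Printing Implicit Defensive.

Import Order.TTheory GRing.Theory Num.Theory.
Local Open Scope ring_scope.

(** * Linear and even maps on power series *)

Lemma linearD_of (K : comNzRingType) (V W : lmodType K) (f : V -> W) :
  linear f -> {morph f : x y / x + y}.
Proof. by move=> fL x y; have := fL 1 x y; rewrite !scale1r. Qed.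

Lemma linear0_of (K : comNzRingType) (V W : lmodType K) (f : V -> W) :
  linear f -> f 0 = 0.
Proof.
by move=> fL; rewrite -[0 in LHS]subr0 (zmod_morphism_linear fL) subrr.
Qed.

Lemma linearN_of (K : comNzRingType) (V W : lmodType K) (f : V -> W) :
  linear f -> {morph f : x / - x}.
Proof. by move=> fL x; rewrite -!scaleN1r (scalable_linear fL). Qed.

Lemma linear_sum_of (K : comNzRingType) (V W : lmodType K) (f : V -> W) I r
    (P : pred I) (F : I -> V) :
  linear f -> f (\sum_(i <- r | P i) F i) = \sum_(i <- r | P i) f (F i).
Proof.
by move=> fL; apply: (big_morph f (linearD_of fL)); apply: linear0_of.
Qed.

Lemma sum_triangle_rev (V : zmodType) (F : nat -> nat -> nat -> V) n :
  \sum_(i < n.+1) \sum_(j < (n - i).+1) F i j (n - i - j)%N =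
  \sum_(k < n.+1) \sum_(j < k.+1) F (k - j)%N j (n - k)%N.
Proof.
rewrite sum_triangle; apply: eq_bigr => k _.
rewrite (reindex_inj rev_ord_inj) /=; apply: eq_bigr => j _.
by rewrite subSS subKn // -ltnS.
Qed.

(** The sum runs over all triples of indices adding up to [n], so exchanging two of them only
    relabels it; this is what moves power series scalars past a series of maps. *)
Lemma sum_triangle_swap (V : zmodType) (F : nat -> nat -> nat -> V) n :
  \sum_(i < n.+1) \sum_(j < (n - i).+1) F i j (n - i - j)%N =
  \sum_(i < n.+1) \sum_(j < (n - i).+1) F j i (n - i - j)%N.
Proof. by rewrite sum_triangle_rev (sum_triangle (fun i j => F j i)). Qed.

Lemma series_map_linear (K : comNzRingType) (V W : lmodType K)
    (psi : nat -> V -> W) :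
  (forall i, linear (psi i)) -> linear (series_map psi).
Proof.
move=> psiL a x y; apply: seriesP => n; rewrite seriesDE seriesZE /=.
under eq_bigr => i _ do
  rewrite (linearD_of (psiL i)) (linear_sum_of _ _ _ (psiL i)).
rewrite big_split /=; congr (_ + _).
under eq_bigr => i _.
  under eq_bigr => j _ do rewrite (scalable_linear (psiL i)).
  over.
rewrite (sum_triangle_swap (fun i j k => a j *: psi i (x k))).
by under [RHS]eq_bigr => i _ do rewrite scaler_sumr.
Qed.

Lemma homogZ (K : comNzRingType) (V : superspace K) p (a : K) (x : V) :
  homog p x -> homog p (a *: x).
Proof.
move=> hx; rewrite -[_ *: _]addr0.
by apply: homog_lin => //; exact: homog0.
Qed.

Lemma homog_sum (K : comNzRingType) (V : superspace K) p I r (P : pred I)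
    (F : I -> V) :
  (forall i, homog p (F i)) -> homog p (\sum_(i <- r | P i) F i).
Proof.
move=> hF; apply: (big_ind (homog p)) => // [|u v hu hv]; first exact: homog0.
by rewrite -[u]scale1r; apply: homog_lin.
Qed.

Lemma series_map_even (K : comNzRingType) (V : superspace K)
    (psi : nat -> V -> V) :
  (forall i, even_map (psi i)) ->
  even_map (V := series_super V) (W := series_super V) (series_map psi).
Proof.
by move=> psiE p x hx n; apply: homog_sum => i; apply: psiE.
Qed.

Lemma signrZ_coef (K : comNzRingType) (V : lmodType K) (b : bool)
    (x : series V) n :
  ((-1) ^+ b *: x) n = (-1) ^+ b *: x n.
Proof. by case: b; rewrite ?expr0 ?expr1 ?scale1r ?scaleN1r. Qed.

(** * The undeformed bracket extended to power series *)

Definition series_bracket (K : comNzRingType) (g : lieSuperalgebra K) :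
    series g -> series g -> series g :=
  series_map2 (@original_bracket K g).

Lemma series_bracketE (K : comNzRingType) (g : lieSuperalgebra K)
    (x y : series g) n :
  series_bracket x y n = \sum_(j < n.+1) bracket g (x j) (y (n - j)%N).
Proof.
rewrite /= big_ord_recl /= subn0 [X in _ + X]big1 ?addr0 // => i _.
by rewrite big1.
Qed.

(** This form shows that bracketing with a fixed right factor is a [series_map], hence linear over
    the power series; it also matches the two sides of skew-symmetry term by term. *)
Lemma series_bracketEr (K : comNzRingType) (g : lieSuperalgebra K)
    (x y : series g) n :
  series_bracket x y n = \sum_(j < n.+1) bracket g (x (n - j)%N) (y j).
Proof.
rewrite series_bracketE (reindex_inj rev_ord_inj) /=; apply: eq_bigr => j _.
by rewrite subSS subKn // -ltnS.
Qed.

Lemma series_bracket_lie (K : comNzRingType) (g : lieSuperalgebra K) :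
  lie_superbracket (V := series_super g) (@series_bracket K g).
Proof.
have [[bLr bLl] bE bS bJ] := bracketP g.
split.
- split=> [x|y].
    rewrite (_ : series_bracket x = series_map (fun j => bracket g (x j))).
      exact: series_map_linear.
    by apply/funext => y; apply: seriesP => n; rewrite series_bracketE.
  rewrite (_ : (@series_bracket K g)^~ y =
               series_map (fun j => (bracket g)^~ (y j))).
    exact: series_map_linear.
  by apply/funext => x; apply: seriesP => n; rewrite series_bracketEr.
- move=> p q x y hx hy n; rewrite series_bracketE.
  by apply: homog_sum => j; apply: bE.
- move=> p q x y hx hy; apply: seriesP => n.
  rewrite seriesNE signrZ_coef series_bracketEr series_bracketE.
  rewrite scaler_sumr -sumrN; apply: eq_bigr => j _; exact: bS.
- move=> p q x y z hx hy; apply: seriesP => n.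
  rewrite seriesDE signrZ_coef !series_bracketE.
  under eq_bigr => i _ do
    rewrite series_bracketE (linear_sum_of _ _ _ (bLr _)).
  under [X in X + _]eq_bigr => k _ do
    rewrite series_bracketE (linear_sum_of _ _ _ (bLl _)).
  under [X in _ *: X]eq_bigr => i _ do
    rewrite series_bracketE (linear_sum_of _ _ _ (bLr _)).
  (* All three double brackets become sums over triples of indices adding up to [n]; the Jacobi
     identity then holds term by term. *)
  rewrite -(sum_triangle
    (fun i j k => bracket g (bracket g (x i) (y j)) (z k))).
  rewrite (sum_triangle_swap
    (fun i j k => bracket g (y i) (bracket g (x j) (z k)))).
  rewrite scaler_sumr -big_split; apply: eq_bigr => i _ /=.
  rewrite scaler_sumr -big_split; apply: eq_bigr => j _ /=.
  exact: bJ.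
Qed.

(** * Multiplication by t and leading coefficients *)

Definition series_var (K : comNzRingType) : series K :=
  Series (fun i => (i == 1%N)%:R).

Lemma series_varZ (K : comNzRingType) (V : lmodType K) (x : series V) n :
  (series_var K *: x) n = if n is m.+1 then x m else 0.
Proof.
rewrite seriesZE; case: n => [|n]; first by rewrite big_ord1 scale0r.
rewrite !big_ord_recl /= scale0r scale1r add0r subn1 big1 ?addr0 // => i _.
by rewrite scale0r.
Qed.

Lemma series_split (K : comNzRingType) (V : lmodType K) (x : series V) :
  x = series_var K *: Series (fun i => x i.+1) + series_const (x 0%N).
Proof.
apply: seriesP => n; rewrite seriesDE series_varZ.
by case: n => [|n]; rewrite ?add0r ?addr0.
Qed.

Lemma series_const_linear (K : comNzRingType) (V : lmodType K) (a : K)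
    (x y : V) :
  series_const (a *: x + y) = series_const a *: series_const x + series_const y.
Proof.
apply: seriesP => n; rewrite seriesDE seriesZE big_ord_recl subn0.
rewrite big1 ?addr0 => [|i _]; last by rewrite scale0r.
by case: n => //= n; rewrite scaler0 addr0.
Qed.

Lemma series_constZ (K : comNzRingType) (V : lmodType K) (a : K)
    (x : series V) n :
  (series_const a *: x) n = a *: x n.
Proof.
rewrite seriesZE big_ord_recl subn0 big1 ?addr0 // => i _.
by rewrite scale0r.
Qed.

Lemma series_const_homog (K : comNzRingType) (V : superspace K) p (x : V) :
  homog p x -> homog (s := series_super V) p (series_const x).
Proof. by move=> hx [|n]; [exact: hx | exact: (@homog0 _ V)]. Qed.

(** Write each argument as its constant term plus t times a series. By bilinearity the terms
    carrying a factor t involve coefficients of [D] of lower order, and these vanish on all series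
    by induction. *)
Lemma bilinear_leading_coef (K : comNzRingType) (U V W : lmodType K)
    (D : series U -> series V -> series W) n :
  bilinear_map D ->
  (forall x y k, (k < n)%N -> D (series_const x) (series_const y) k = 0) ->
  forall u v, D u v n = D (series_const (u 0%N)) (series_const (v 0%N)) n.
Proof.
move=> [DLr DLl]; elim: n => [|n IHn] D0 u v.
  rewrite {1}[v]series_split DLr seriesDE series_varZ add0r.
  by rewrite {1}[u]series_split (DLl _ _ _ _) seriesDE series_varZ add0r.
have Dn x y : D x y n = 0.
  rewrite IHn => [|x' y' k lt_kn]; first exact: D0.
  by apply: D0; apply: ltnW.
rewrite {1}[v]series_split DLr seriesDE series_varZ Dn add0r.
by rewrite {1}[u]series_split (DLl _ _ _ _) seriesDE series_varZ Dn add0r.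
Qed.

(** * Cocycles and the defect of an approximate equivalence *)

Definition coboundary (K : comNzRingType) (g : lieSuperalgebra K)
    (psi : g -> g) (x y : g) : g :=
  psi (bracket g x y) - bracket g (psi x) y - bracket g x (psi y).

Definition super_cochain (K : comNzRingType) (V : superspace K)
    (chi : V -> V -> V) : Prop :=
  [/\ bilinear_map chi, even_map2 chi & super_skew chi].

(** The identity is the part linear in s of the Jacobi identity of the bracket [,] + s [chi]. *)
Definition super_cocycle (K : comNzRingType) (g : lieSuperalgebra K)
    (chi : g -> g -> g) : Prop :=
  super_cochain chi /\
  forall p q x y z, homog p x -> homog q y ->
    chi x (bracket g y z) + bracket g x (chi y z) =
    chi (bracket g x y) z + bracket g (chi x y) z +
    (-1) ^+ (p && q) *: (chi y (bracket g x z) + bracket g y (chi x z)).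

Definition defect (K : comNzRingType) (g : lieSuperalgebra K)
    (phi : nat -> g -> g -> g) (psi : nat -> g -> g) (x y : series g) :
    series g :=
  series_bracket (series_map psi x) (series_map psi y) -
  series_map psi (series_map2 phi x y).

Lemma series_bracket_coefl (K : comNzRingType) (g : lieSuperalgebra K)
    (x y : series g) n :
  (forall k, (k < n)%N -> y k = 0) ->
  series_bracket x y n = bracket g (x 0%N) (y n).
Proof.
have [[bLr _] _ _ _] := bracketP g.
move=> y0; rewrite series_bracketE big_ord_recl subn0 big1 ?addr0 // => i _.
by rewrite y0 ?(linear0_of (bLr _)) //= /bump /= add1n ltn_subrL ltn0Sn /=;
   exact: leq_ltn_trans (ltn_ord i).
Qed.

Lemma series_bracket_coefr (K : comNzRingType) (g : lieSuperalgebra K)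
    (x y : series g) n :
  (forall k, (k < n)%N -> x k = 0) ->
  series_bracket x y n = bracket g (x n) (y 0%N).
Proof.
have [[_ bLl] _ _ _] := bracketP g.
move=> y0; rewrite series_bracketEr big_ord_recl subn0 big1 ?addr0 // => i _.
by rewrite y0 ?(linear0_of (bLl _)) //= /bump /= add1n ltn_subrL ltn0Sn /=;
   exact: leq_ltn_trans (ltn_ord i).
Qed.

Lemma defect_cochain (K : comNzRingType) (g : lieSuperalgebra K)
    (phi : nat -> g -> g -> g) (psi : nat -> g -> g) :
  deformation phi -> (forall i, linear (psi i)) ->
  (forall i, even_map (psi i)) ->
  super_cochain (V := series_super g) (defect phi psi).
Proof.
move=> [_ _ [[fLr fLl] fE fS _]] psiL psiE.
have [[mLr mLl] mE mS _] := series_bracket_lie g.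
have PL := series_map_linear psiL; have PE := series_map_even psiE.
split; first split=> [x|y] a u v; rewrite /defect.
- by rewrite PL mLr fLr PL scalerBr opprD addrACA.
- by rewrite PL (mLl _ _ _ _) (fLl _ _ _ _) PL scalerBr opprD addrACA.
- move=> p q x y hx hy; rewrite addrC -scaleN1r.
  by apply: homog_lin; [apply: PE; apply: fE | apply: mE; apply: PE].
- move=> p q x y hx hy; rewrite /defect.
  rewrite (mS _ _ _ _ (PE _ _ hx) (PE _ _ hy)) (fS _ _ _ _ hx hy).
  by rewrite (linearN_of PL) (scalable_linear PL) -opprD -scalerBr.
Qed.

(** The Jacobi identity of the undeformed bracket at the images under psi,
    minus psi applied to the Jacobi identity of the deformed bracket. *)
Lemma defect_jacobi (K : comNzRingType) (g : lieSuperalgebra K)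
    (phi : nat -> g -> g -> g) (psi : nat -> g -> g) p q
    (x y z : series_super g) :
  deformation phi -> (forall i, linear (psi i)) ->
  (forall i, even_map (psi i)) -> homog p x -> homog q y ->
  defect phi psi x (series_map2 phi y z) +
    series_bracket (series_map psi x) (defect phi psi y z) =
  defect phi psi (series_map2 phi x y) z +
    series_bracket (defect phi psi x y) (series_map psi z) +
  (-1) ^+ (p && q) *: (defect phi psi y (series_map2 phi x z) +
    series_bracket (series_map psi y) (defect phi psi x z)).
Proof.
move=> [_ _ [_ _ _ fJ]] psiL psiE hx hy.
have [[mLr mLl] _ _ mJ] := series_bracket_lie g.
have PL := series_map_linear psiL; have PE := series_map_even psiE.
pose P := series_map psi.
have expand u v w : defect phi psi u (series_map2 phi v w) +
      series_bracket (series_map psi u) (defect phi psi v w) =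
    series_bracket (P u) (series_bracket (P v) (P w)) -
      P (series_map2 phi u (series_map2 phi v w)).
  by rewrite /defect (zmod_morphism_linear (mLr _)) addrC subrKA.
have expand' : defect phi psi (series_map2 phi x y) z +
      series_bracket (defect phi psi x y) (series_map psi z) =
    series_bracket (series_bracket (P x) (P y)) (P z) -
      P (series_map2 phi (series_map2 phi x y) z).
  by rewrite /defect (zmod_morphism_linear (mLl _)) addrC subrKA.
rewrite !expand expand' (mJ _ _ _ _ _ (PE _ _ hx) (PE _ _ hy)) /P.
rewrite (fJ _ _ _ _ _ hx hy) (linearD_of PL) (scalable_linear PL).
by rewrite opprD addrACA -scalerBr.
Qed.

(** Take the coefficient of t^n in [defect_jacobi] at constant series. The defect vanishes below
    order [n] on all series, so everything paired with it enters only through its constant term,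
    where the deformed bracket is the original one and psi is the identity. *)
Lemma defect_cocycle (K : comNzRingType) (g : lieSuperalgebra K)
    (phi : nat -> g -> g -> g) (psi : nat -> g -> g) n :
  deformation phi -> (forall i, linear (psi i)) ->
  (forall i, even_map (psi i)) -> psi 0%N = id ->
  (forall x y k, (k < n)%N ->
    defect phi psi (series_const x) (series_const y) k = 0) ->
  super_cocycle (g := g)
    (fun x y => defect phi psi (series_const x) (series_const y) n).
Proof.
move=> phiD psiL psiE psi0 D0.
have [[DLr DLl] DE DS] := defect_cochain phiD psiL psiE.
have lead := bilinear_leading_coef (conj DLr DLl) D0.
have low u v k : (k < n)%N -> defect phi psi u v k = 0.
  move=> lt_kn; rewrite (bilinear_leading_coef (conj DLr DLl)); first exact: D0.
  by move=> x y j lt_jk; apply: D0; exact: ltn_trans lt_kn.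
have f0 (x y : g) : series_map2 phi (series_const x) (series_const y) 0%N =
    bracket g x y.
  by rewrite /= !big_ord1; have [-> _ _] := phiD.
have P0 (x : g) : series_map psi (series_const x) 0%N = x.
  by rewrite /= big_ord1 psi0.
split; first split; first split=> [x|y] a u v.
- by rewrite series_const_linear DLr seriesDE series_constZ.
- by rewrite series_const_linear (DLl _ _ _ _) seriesDE series_constZ.
- move=> p q x y hx hy; apply: DE; exact: series_const_homog.
- move=> p q x y hx hy.
  rewrite (DS p q (series_const x)) ?seriesNE ?signrZ_coef //;
    exact: series_const_homog.
move=> p q x y z hx hy.
have := @defect_jacobi _ _ phi psi p q (series_const x) (series_const y)
  (series_const z) phiD psiL psiE
  (series_const_homog hx) (series_const_homog hy).
move: (defect phi psi) {DLr DLl DE DS D0} lead low => D lead low.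
move=> /(congr1 (fun s : series g => s n)).
rewrite !seriesDE signrZ_coef !seriesDE.
rewrite !(lead _ (series_map2 _ _ _)) (lead (series_map2 _ _ _)) !f0.
rewrite !(series_bracket_coefl _ (low _ _)) (series_bracket_coefr _ (low _ _)).
by rewrite !P0.
Qed.

(** * Order-by-order construction of the equivalence *)

Definition cocycles_are_coboundaries (K : comNzRingType)
    (g : lieSuperalgebra K) : Prop :=
  forall chi : g -> g -> g, super_cocycle chi ->
  exists eta : g -> g,
    [/\ linear eta, even_map eta & forall x y, chi x y = coboundary eta x y].

Definition correct_at (V : zmodType) (n : nat) (eta : V -> V)
    (psi : nat -> V -> V) (i : nat) (x : V) : V :=
  psi i x + (if i == n then eta x else 0).

Lemma correct_at_linear (K : comNzRingType) (V : lmodType K) n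
    (eta : V -> V) (psi : nat -> V -> V) i :
  linear eta -> linear (psi i) -> linear (correct_at n eta psi i).
Proof.
move=> etaL psiL a x y; rewrite /correct_at psiL scalerDr addrACA.
by case: eqP => _; rewrite ?etaL // scaler0 !addr0.
Qed.

Lemma correct_at_even (K : comNzRingType) (V : superspace K) n
    (eta : V -> V) (psi : nat -> V -> V) i :
  even_map eta -> even_map (psi i) -> even_map (correct_at n eta psi i).
Proof.
move=> etaE psiE p x hx; rewrite /correct_at -[psi i x]scale1r.
apply: homog_lin; first exact: psiE.
by case: eqP => _; [exact: etaE | exact: homog0].
Qed.

Lemma series_map_correct_at (K : comNzRingType) (V : lmodType K) n
    (eta : V -> V) (psi : nat -> V -> V) (x : series V) k :
  (k <= n)%N ->
  series_map (correct_at n eta psi) x k =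
  series_map psi x k + (if k == n then eta (x 0%N) else 0).
Proof.
move=> le_kn; rewrite /= big_split /=; congr (_ + _).
rewrite big_ord_recr /= subnn big1 ?add0r // => i _.
by rewrite ltn_eqF // (leq_trans (ltn_ord i)).
Qed.

(** The correction changes the image of [u] by [R u], which starts in order [n] with [eta (u 0)]. So
    in order [n] the bracket of the images gains [[eta x], [y]] + [[x], [eta y]] and the image of
    the bracket gains [eta] [[x], [y]]; since [n] is positive, constant terms stay fixed. *)
Lemma correct_defect (K : comNzRingType) (g : lieSuperalgebra K)
    (phi : nat -> g -> g -> g) (psi : nat -> g -> g) n (eta : g -> g) :
  phi 0%N = bracket g -> psi 0%N = id -> (0 < n)%N ->
  forall x y k, (k <= n)%N ->
  defect phi (correct_at n eta psi) (series_const x) (series_const y) k =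
  defect phi psi (series_const x) (series_const y) k -
    (if k == n then coboundary eta x y else 0).
Proof.
move=> phi0 psi0 n_gt0 x y k le_kn.
have [[bLr bLl] _ _ _] := bracketP g.
have [[mLr mLl] _ _ _] := series_bracket_lie g.
pose R u := series_map (correct_at n eta psi) u - series_map psi u.
have RE u j : (j <= n)%N -> R u j = if j == n then eta (u 0%N) else 0.
  by move=> le_jn; rewrite seriesDE series_map_correct_at // addrAC subrr add0r.
have R0 u j : (j < k)%N -> R u j = 0.
  move=> lt_jk; have lt_jn := leq_trans lt_jk le_kn.
  by rewrite RE ?ltn_eqF // ltnW.
have PR u : series_map (correct_at n eta psi) u = series_map psi u + R u.
  by rewrite addrC subrK.
clearbody R.
have f0 : series_map2 phi (series_const x) (series_const y) 0%N =
    bracket g x y.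
  by rewrite /= !big_ord1 phi0.
have P0 (z : g) : series_map psi (series_const z) 0%N = z.
  by rewrite /= big_ord1 psi0.
have P'0 (z : g) :
    (series_map psi (series_const z) + R (series_const z)) 0%N = z.
  by rewrite seriesDE P0 RE // ltn_eqF // addr0.
rewrite /defect !PR (linearD_of (mLl _)) (linearD_of (mLr _)).
rewrite !(seriesDE, seriesNE) (series_bracket_coefl _ (R0 _)).
rewrite (series_bracket_coefr _ (R0 _)) P0 P'0 !RE //.
rewrite f0 /coboundary.
case: eqP => _; last first.
  by rewrite (linear0_of (bLr _)) (linear0_of (bLl _)) !addr0 subr0.
rewrite /= !opprB opprD -!addrA; congr (_ + _).
by rewrite [RHS]addrCA; congr (_ + _); rewrite addrCA.
Qed.

Lemma deformation_trivial (K : comNzRingType) (g : lieSuperalgebra K)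
    (phi : nat -> g -> g -> g) :
  cocycles_are_coboundaries g -> deformation phi -> trivial_deformation phi.
Proof.
move=> H2 phiD; have [phi0 _ _] := phiD.
pose approx n psi := [/\ psi 0%N = id,
  forall i, linear (psi i) /\ even_map (psi i) &
  forall (x y : g) k, (k < n)%N ->
    defect phi psi (series_const x) (series_const y) k = 0].
(* The hypotheses stand under the existential so that choice yields one correction for every pair of
   an order and a map. *)
have step n psi : exists eta : g -> g, (0 < n)%N -> approx n psi ->
    approx n.+1 (correct_at n eta psi).
  have [[n_gt0 [psi0 psiLE D0]]|no] := pselect ((0 < n)%N /\ approx n psi).
    have psiL i := (psiLE i).1; have psiE i := (psiLE i).2.
    have [eta [etaL etaE eta_cob]] :=
      H2 _ (defect_cocycle phiD psiL psiE psi0 D0).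
    exists eta => _ _; split=> [|i|x y k].
    - by apply/funext => x; rewrite /correct_at psi0 ltn_eqF ?addr0.
    - by split; [exact: correct_at_linear | exact: correct_at_even].
    rewrite ltnS => le_kn; rewrite correct_defect //.
    case: eqP => [->|/eqP neq_kn]; first by rewrite eta_cob subrr.
    by rewrite subr0 D0 // ltn_neqAle neq_kn.
  by exists id => n_gt0 psiP; case: no.
have /choice[eta etaP] : forall np : nat * (nat -> g -> g), exists eta : g -> g,
    (0 < np.1)%N -> approx np.1 np.2 ->
    approx np.1.+1 (correct_at np.1 eta np.2).
  by move=> [n psi]; exact: step.
(* [S 0] is the identity, and passing from [S m] to [S m.+1] alters only the coefficient of index
   [m.+1]; thus [S n] is correct through order [n] inclusive. *)
pose fix S n : nat -> g -> g :=
  if n is m.+1 then correct_at n (eta (n, S m)) (S m)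
  else fun i x => if i is 0%N then x else 0.
have SP n : approx n.+1 (S n).
  elim: n => [|n IHn]; last exact: (etaP (n.+1, S n)).
  split=> // [[|i]|x y [|//] _].
  - by split.
  - split=> [a x y|p x _]; last exact: homog0.
    by rewrite /= scaler0 addr0.
  - by rewrite /defect /= !big_ord1 phi0 subrr.
(* The coefficient of index [i] is final from stage [i] on, so the diagonal [S i i] is the t-adic
   limit of the [S n]. *)
have S_stable n k i : (i <= n)%N -> S (n + k)%N i = S n i.
  move=> le_in; elim: k => [|k IHk]; first by rewrite addn0.
  rewrite addnS /= -IHk; apply/funext => x.
  by rewrite /correct_at ltn_eqF ?addr0 // ltnS (leq_trans le_in) ?leq_addr.
exists (fun i => S i i); split=> [|i|x y].
- by [].
- by have [_ SLE _] := SP i; exact: SLE.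
apply: seriesP => n; have [_ _ SD] := SP n.
have mapE (u : series g) k : (k <= n)%N ->
    series_map (fun i => S i i) u k = series_map (S n) u k.
  move=> le_kn; apply: eq_bigr => i _; congr (_ _).
  have le_in : (i <= n)%N by apply: leq_trans le_kn; rewrite -ltnS.
  by rewrite -(subnKC le_in) S_stable.
rewrite mapE //; apply/esym/eqP; rewrite -subr_eq0; apply/eqP.
rewrite -[RHS](SD x y n (ltnSn n)) /defect seriesDE; congr (_ - _).
rewrite [LHS]series_bracketE series_bracketE; apply: eq_bigr => j _.
by rewrite !mapE // ?leq_subr // -ltnS.
Qed.

(** * Coboundaries and differences of cocycles *)

Lemma coboundary_cocycle (K : comNzRingType) (g : lieSuperalgebra K)
    (psi : g -> g) :
  linear psi -> even_map psi -> super_cocycle (coboundary psi).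
Proof.
move=> psiL psiE; have [[bLr bLl] bE bS bJ] := bracketP g.
have psiD := linearD_of psiL; have psiZ := scalable_linear psiL.
have bBr x := zmod_morphism_linear (bLr x).
have bBl y := zmod_morphism_linear (bLl y).
split; first split; first split=> [x|y] a u v; rewrite /coboundary.
- rewrite bLr psiL bLr psiL bLr !scalerBr !opprD.
  by rewrite [X in X + _]addrACA [LHS]addrACA.
- rewrite (bLl _ _ _ _) psiL (bLl _ _ _ _) psiL (bLl _ _ _ _) !scalerBr !opprD.
  by rewrite [X in X + _]addrACA [LHS]addrACA.
- move=> p q x y hx hy; rewrite /coboundary addrC -scaleN1r.
  apply: homog_lin; first by apply: bE => //; exact: psiE.
  rewrite addrC -scaleN1r.
  apply: homog_lin; first by apply: bE => //; exact: psiE.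
  by apply: psiE; exact: bE.
- move=> p q x y hx hy; rewrite /coboundary.
  rewrite (bS _ _ _ _ hx hy) (bS _ _ _ _ hx (psiE _ _ hy)).
  rewrite (bS _ _ _ _ (psiE _ _ hx) hy) (linearN_of psiL) psiZ.
  by rewrite -!opprD -!scalerBr; congr (- (_ *: _)); rewrite addrAC.
move=> p q x y z hx hy.
(* The terms with psi on an inner bracket cancel. What remains is psi applied to the Jacobi
   identity, minus the three Jacobi identities with psi inserted in one argument. *)
have expand u v w : coboundary psi u (bracket g v w) +
      bracket g u (coboundary psi v w) =
    psi (bracket g u (bracket g v w)) - bracket g u (bracket g v (psi w)) -
      bracket g (psi u) (bracket g v w) - bracket g u (bracket g (psi v) w).
  rewrite /coboundary !bBr !addrA subrK.
  by rewrite addrAC [X in X - _]addrAC.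
have expand' : coboundary psi (bracket g x y) z +
      bracket g (coboundary psi x y) z =
    psi (bracket g (bracket g x y) z) - bracket g (bracket g x y) (psi z) -
      bracket g (bracket g (psi x) y) z - bracket g (bracket g x (psi y)) z.
  rewrite /coboundary !bBl [X in X + _]addrAC !addrA subrK //.
rewrite (expand x) (expand y) expand' [_ - bracket g (psi y) _ - _]addrAC.
rewrite (bJ _ _ _ _ _ hx hy) (bJ _ _ _ _ _ hx hy).
rewrite (bJ _ _ _ _ _ (psiE _ _ hx) hy) (bJ _ _ _ _ _ hx (psiE _ _ hy)).
rewrite psiD psiZ !opprD [X in X + _ + _ = _]addrACA -scalerBr.
by rewrite [X in X + _ = _]addrACA -scalerBr addrACA -scalerBr.
Qed.

Lemma super_cocycleB (K : comNzRingType) (g : lieSuperalgebra K)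
    (chi chi' : g -> g -> g) :
  super_cocycle chi -> super_cocycle chi' ->
  super_cocycle (fun x y => chi x y - chi' x y).
Proof.
have [[bLr bLl] _ _ _] := bracketP g.
have bBr x := zmod_morphism_linear (bLr x).
have bBl y := zmod_morphism_linear (bLl y).
move=> [[[cLr cLl] cE cS] cJ] [[[cLr' cLl'] cE' cS'] cJ'].
split; first split; first split=> [x|y] a u v.
- by rewrite cLr cLr' scalerBr opprD addrACA.
- by rewrite (cLl _ _ _ _) (cLl' _ _ _ _) scalerBr opprD addrACA.
- move=> p q x y hx hy; rewrite addrC -scaleN1r.
  by apply: homog_lin; [exact: cE' | exact: cE].
- move=> p q x y hx hy; rewrite (cS _ _ _ _ hx hy) (cS' _ _ _ _ hx hy).
  by rewrite -opprD -scalerBr.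
move=> p q x y z hx hy; rewrite !bBr bBl.
rewrite [LHS]addrACA -opprD (cJ _ _ _ _ _ hx hy) (cJ' _ _ _ _ _ hx hy).
by rewrite opprD [LHS]addrACA -scalerBr; congr (_ + _ *: _);
  rewrite opprD [LHS]addrACA.
Qed.

(** * Normalised cocycles of osp(1,2) on the basis *)

Lemma osp_bracket_e (F : numFieldType) i j :
  (i < 5)%N -> (j < 5)%N ->
  osp_bracket (osp_e F i.+1) (osp_e F j.+1) = osp_basis_bracket F i.+1 j.+1.
Proof.
move=> lt_i lt_j; rewrite /osp_bracket (bigD1 (Ordinal lt_i)) //=.
rewrite (bigD1 (Ordinal lt_j)) //= !mxE !eqxx mulr1 scale1r.
rewrite !big1 ?addr0 // => [k|k] neq_k; last first.
  by rewrite !mxE eqSS (negbTE (neq_k : k != j :> nat)) mulr0 scale0r.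
apply: big1 => l _.
by rewrite !mxE eqSS (negbTE (neq_k : k != i :> nat)) mul0r scale0r.
Qed.

Lemma osp_homog_e (F : numFieldType) k : osp_homog (osp_odd k) (osp_e F k).
Proof. by move=> j; rewrite mxE; case: (_.+1 =P k) => // ->; rewrite eqxx. Qed.

Lemma osp_decomp (F : numFieldType) (x : 'rV[F]_5) :
  x = \sum_(i < 5) x 0 i *: osp_e F i.+1.
Proof.
apply/rowP => j; rewrite summxE (bigD1 j) //= !mxE eqxx mulr1 big1 ?addr0 //.
move=> i neq_ij; rewrite !mxE eqSS (eq_sym (j : nat)).
by rewrite (negbTE (neq_ij : i != j :> nat)) mulr0.
Qed.

Lemma osp_odd_decomp (F : numFieldType) (x : 'rV[F]_5) :
  osp_homog true x ->
  x = x 0 (inord 3) *: osp_e F 4 + x 0 (inord 4) *: osp_e F 5.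
Proof.
move=> /osp_homog_coord[x0 x1 x2]; rewrite [LHS]osp_decomp.
rewrite (eq_bigr (fun i : 'I_5 => x 0 (inord i) *: osp_e F i.+1)); last first.
  by move=> i _; rewrite inord_val.
by rewrite !big_ord_recl big_ord0 /= x0 x1 x2 !scale0r !add0r addr0.
Qed.

(** Here [l = r] is one coordinate of a cocycle identity and [c] inverts the coefficient with which
    the unknown [t] occurs in [l - r]. *)
Lemma lin_solve (F : fieldType) (c l r t : F) :
  l = r -> t = c * (l - r) -> t = 0.
Proof. by move=> -> ->; rewrite subrr mulr0. Qed.

Lemma osp_cocycle_eq0 (F : numFieldType)
    (chi : 'rV[F]_5 -> 'rV[F]_5 -> 'rV[F]_5) :
  super_cocycle (g := osp12 F) chi ->
  chi (osp_e F 4) (osp_e F 4) = 0 -> chi (osp_e F 4) (osp_e F 5) = 0 ->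
  chi (osp_e F 5) (osp_e F 5) = 0 ->
  chi (osp_e F 1) (osp_e F 5) 0 (inord 3) = 0 ->
  forall x y, chi x y = 0.
Proof.
move=> [[[cLr cLl] cE cS] cJ] c44 c45 c55 c15.
have [bLr bLl] := osp_bilinear F.
have cDr x u v : chi x (u + v) = chi x u + chi x v := linearD_of (cLr x) u v.
have cZr a x v : chi x (a *: v) = a *: chi x v := scalable_linear (cLr x) a v.
have cNr x v : chi x (- v) = - chi x v := linearN_of (cLr x) v.
have c0r x : chi x 0 = 0 := linear0_of (cLr x).
have cDl y u v : chi (u + v) y = chi u y + chi v y := linearD_of (cLl y) u v.
have cZl a y v : chi (a *: v) y = a *: chi v y := scalable_linear (cLl y) a v.
have cNl y v : chi (- v) y = - chi v y := linearN_of (cLl y) v.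
have c0l y : chi 0 y = 0 := linear0_of (cLl y).
have bDr x u v : osp_bracket x (u + v) = osp_bracket x u + osp_bracket x v :=
  linearD_of (bLr x) u v.
have bZr a x v : osp_bracket x (a *: v) = a *: osp_bracket x v :=
  scalable_linear (bLr x) a v.
have b0r x : osp_bracket x 0 = 0 := linear0_of (bLr x).
have bDl y u v : osp_bracket (u + v) y = osp_bracket u y + osp_bracket v y :=
  linearD_of (bLl y) u v.
have bZl a y v : osp_bracket (a *: v) y = a *: osp_bracket v y :=
  scalable_linear (bLl y) a v.
have b0l y : osp_bracket 0 y = 0 := linear0_of (bLl y).
have J i j k : (i < 5)%N -> (j < 5)%N -> (k < 5)%N ->
    chi (osp_e F i.+1) (osp_basis_bracket F j.+1 k.+1) +
      osp_bracket (osp_e F i.+1) (chi (osp_e F j.+1) (osp_e F k.+1)) =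
    chi (osp_basis_bracket F i.+1 j.+1) (osp_e F k.+1) +
      osp_bracket (chi (osp_e F i.+1) (osp_e F j.+1)) (osp_e F k.+1) +
    (-1) ^+ (osp_odd i.+1 && osp_odd j.+1) *:
      (chi (osp_e F j.+1) (osp_basis_bracket F i.+1 k.+1) +
       osp_bracket (osp_e F j.+1) (chi (osp_e F i.+1) (osp_e F k.+1))).
  move=> lt_i lt_j lt_k; rewrite -!osp_bracket_e //.
  by apply: cJ; exact: osp_homog_e.
have skewE i j : osp_odd i = false ->
    chi (osp_e F j) (osp_e F i) = - chi (osp_e F i) (osp_e F j).
  move=> hi; rewrite (cS _ _ _ _ (@osp_homog_e F i) (@osp_homog_e F j)) hi /=.
  by rewrite expr0 scale1r.
have c54 : chi (osp_e F 5) (osp_e F 4) = 0.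
  rewrite (cS _ _ _ _ (@osp_homog_e F 4) (@osp_homog_e F 5)) c45.
  by rewrite scaler0 oppr0.
have odd1 i j : osp_odd i = false -> osp_odd j = true ->
    exists a b, chi (osp_e F i) (osp_e F j) = a *: osp_e F 4 + b *: osp_e F 5.
  move=> hi hj; exists (chi (osp_e F i) (osp_e F j) 0 (inord 3)).
  exists (chi (osp_e F i) (osp_e F j) 0 (inord 4)); apply: osp_odd_decomp.
  by have := cE _ _ _ _ (@osp_homog_e F i) (@osp_homog_e F j); rewrite hi hj.
have chiE := (cDr, cZr, cNr, c0r, cDl, cZl, cNl, c0l,
  bDr, bZr, b0r, bDl, bZl, b0l,
  c44, c45, c54, c55).
have at_coord k (u v : 'rV[F]_5) : u = v -> u 0 k = v 0 k by move->.
(* As [e4,e4] = e1/2, the triple (e4,e4,e4) gives -chi(e1,e4)/2 = chi(e1,e4). The triple (e5,e5,e5)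
   treats chi(e2,e5) in the same way. *)
have c14 : chi (osp_e F 1) (osp_e F 4) = 0.
  have := J 3%N 3%N 3%N isT isT isT.
  rewrite /osp_basis_bracket /= !(chiE, skewE 1%N 4%N) // => /at_coord E.
  apply/rowP => k; move/(_ k): E; rewrite !mxE => E.
  by apply: (lin_solve (c := - (2 / 3)) E); field.
have c25 : chi (osp_e F 2) (osp_e F 5) = 0.
  have := J 4%N 4%N 4%N isT isT isT.
  rewrite /osp_basis_bracket /= !(chiE, skewE 2%N 5%N) // => /at_coord E.
  apply/rowP => k; move/(_ k): E; rewrite !mxE => E.
  by apply: (lin_solve (c := 2 / 3) E); field.
(* The mixed triples (e4,e4,e5) and (e5,e5,e4) express the values at e3 through chi(e1,e5) and
   chi(e2,e4). *)
have c34 : chi (osp_e F 3) (osp_e F 4) = - chi (osp_e F 1) (osp_e F 5).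
  have := J 3%N 3%N 4%N isT isT isT.
  rewrite /osp_basis_bracket /= !(chiE, skewE 3%N 4%N) // => /at_coord E.
  apply/rowP => k; move/(_ k): E; rewrite !mxE => E; apply/eqP.
  by rewrite -subr_eq0; apply/eqP; apply: (lin_solve (c := - 2) E); field.
have c35 : chi (osp_e F 3) (osp_e F 5) = chi (osp_e F 2) (osp_e F 4).
  have := J 4%N 4%N 3%N isT isT isT.
  rewrite /osp_basis_bracket /= !(chiE, skewE 3%N 5%N) // => /at_coord E.
  apply/rowP => k; move/(_ k): E; rewrite !mxE => E; apply/eqP.
  by rewrite -subr_eq0; apply/eqP; apply: (lin_solve (c := - 2) E); field.
(* By evenness chi(e1,e5) = a e4 + b e5 and chi(e2,e4) = c e4 + d e5; the normalisation [c15] says a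
   = 0. *)
have [a [b c15E]] := odd1 1%N 5%N erefl erefl.
have a0 : a = 0.
  by move: c15; rewrite c15E !mxE inordK //= mulr1 mulr0 addr0.
rewrite a0 scale0r add0r in c15E.
have [c [d c24]] := odd1 2%N 4%N erefl erefl.
(* The triple (e1,e5,e5) gives -chi(e1,e2)/2 = 2b [e5,e5] = -b e2. *)
have c12 : chi (osp_e F 1) (osp_e F 2) = (2 * b) *: osp_e F 2.
  have := J 0%N 4%N 4%N isT isT isT.
  rewrite /osp_basis_bracket /= !(chiE, c15E, osp_bracket_e) //.
  rewrite /osp_basis_bracket /= => /at_coord E.
  apply/rowP => k; move/(_ k): E; rewrite !mxE !expr0 => E; apply/eqP.
  by rewrite -subr_eq0; apply/eqP; apply: (lin_solve (c := - 2) E); field.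
(* The triple (e2,e4,e4) evaluates chi(e1,e2) again: -b e2 = c e1 + (d/2) e3, and the basis vectors
   are independent. *)
have [b0 c0 d0] : [/\ b = 0, c = 0 & d = 0].
  have := J 1%N 3%N 3%N isT isT isT.
  rewrite /osp_basis_bracket /=.
  rewrite !(chiE, c24, skewE 1%N 2%N, c12, osp_bracket_e) //.
  rewrite /osp_basis_bracket /= expr0 expr1 => /at_coord E.
  split.
  - move: (E (@Ordinal 5 1 isT)); rewrite !mxE /= => {}E.
    by apply: (lin_solve (c := -1) E); field.
  - move: (E (@Ordinal 5 0 isT)); rewrite !mxE /= => {}E.
    by apply: (lin_solve (c := -1) E); field.
  - move: (E (@Ordinal 5 2 isT)); rewrite !mxE /= => {}E.
    by apply: (lin_solve (c := -2) E); field.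
rewrite b0 mulr0 scale0r in c12; rewrite b0 scale0r in c15E.
rewrite c0 d0 !scale0r addr0 in c24.
rewrite c15E oppr0 in c34; rewrite c24 in c35.
(* Since [e4,e5] = e3/4, the triples (e1,e4,e5) and (e2,e4,e5) reach chi(e1,e3) and chi(e2,e3). *)
have c13 : chi (osp_e F 1) (osp_e F 3) = 0.
  have := J 0%N 3%N 4%N isT isT isT.
  rewrite /osp_basis_bracket /= !(chiE, c14, c15E) // => /at_coord E.
  apply/rowP => k; move/(_ k): E; rewrite !mxE => E.
  by apply: (lin_solve (c := 4) E); field.
have c23 : chi (osp_e F 2) (osp_e F 3) = 0.
  have := J 1%N 3%N 4%N isT isT isT.
  rewrite /osp_basis_bracket /= !(chiE, c24, c25) // => /at_coord E.
  apply/rowP => k; move/(_ k): E; rewrite !mxE => E.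
  by apply: (lin_solve (c := 4) E); field.
have cdiag i : osp_odd i = false -> chi (osp_e F i) (osp_e F i) = 0.
  move=> hi; apply/rowP => k; have := at_coord k _ _ (skewE i i hi).
  by rewrite !mxE => E; apply: (lin_solve (c := 2^-1) E); field.
have upper i j : (i <= j)%N -> (j < 5)%N ->
    chi (osp_e F i.+1) (osp_e F j.+1) = 0.
  by case: i j => [|[|[|[|[|i]]]]] [|[|[|[|[|j]]]]] // _ _; rewrite ?cdiag.
move=> x y; rewrite [x]osp_decomp [y]osp_decomp.
rewrite (linear_sum_of _ _ _ (cLl _)) big1 // => i _.
rewrite (linear_sum_of _ _ _ (cLr _)) big1 // => j _.
rewrite !(cZr, cZl).
have [le_ij|/ltnW le_ji] := leqP i j; first by rewrite upper // !scaler0.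
rewrite (cS _ _ _ _ (@osp_homog_e F j.+1) (@osp_homog_e F i.+1)) upper //.
by rewrite scaler0 oppr0 !scaler0.
Qed.

(** * The coboundary that normalises a cocycle *)

Definition osp_lin (F : numFieldType) (w : nat -> 'rV[F]_5) (x : 'rV[F]_5) :
    'rV[F]_5 :=
  \sum_(i < 5) x 0 i *: w i.+1.

Lemma osp_lin_linear (F : numFieldType) (w : nat -> 'rV[F]_5) :
  linear (osp_lin w).
Proof.
move=> a x y; rewrite /osp_lin scaler_sumr -big_split; apply: eq_bigr => i _ /=.
by rewrite !mxE scalerDl scalerA.
Qed.

Lemma osp_lin_e (F : numFieldType) (w : nat -> 'rV[F]_5) i :
  (i < 5)%N -> osp_lin w (osp_e F i.+1) = w i.+1.
Proof.
move=> lt_i; rewrite /osp_lin (bigD1 (Ordinal lt_i)) //= mxE eqxx scale1r.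
rewrite big1 ?addr0 // => k neq_k.
by rewrite mxE eqSS (negbTE (neq_k : k != i :> nat)) scale0r.
Qed.

Lemma osp_lin_even (F : numFieldType) (w : nat -> 'rV[F]_5) :
  (forall i, (i < 5)%N -> osp_homog (osp_odd i.+1) (w i.+1)) ->
  even_map (V := osp_super F) (W := osp_super F) (osp_lin w).
Proof.
move=> wE p x hx; apply: homog_sum => i.
have [eq_p|neq_p] := eqVneq (osp_odd i.+1) p.
  by rewrite -eq_p; apply: (@homogZ F (osp_super F)); exact: wE.
by rewrite (hx _ neq_p) scale0r; exact: homog0.
Qed.

Lemma osp_cocycles_are_coboundaries (F : numFieldType) :
  cocycles_are_coboundaries (osp12 F).
Proof.
move=> phi phiC; have [[_ phiE _] _] := phiC.
have [bLr bLl] := osp_bilinear F.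
have bZr a x v : osp_bracket x (a *: v) = a *: osp_bracket x v :=
  scalable_linear (bLr x) a v.
have bZl a y v : osp_bracket (a *: v) y = a *: osp_bracket v y :=
  scalable_linear (bLl y) a v.
have bDl y u v : osp_bracket (u + v) y = osp_bracket u y + osp_bracket v y :=
  linearD_of (bLl y) u v.
pose e := osp_e F.
(* The values phi e_i e_j on odd vectors force psi on the even part up to the
   choice of psi on the odd part; c makes the e4-coordinate of
   (phi - coboundary psi) e1 e5 vanish. *)
pose c := phi (e 1%N) (e 5%N) 0 (inord 3) / 2 +
  osp_bracket (phi (e 4%N) (e 4%N)) (e 5%N) 0 (inord 3).
(* The leading 0 pads index 0, the basis being numbered from 1. With psi = c on the odd part, the
   coboundary at (e4,e4) is psi(e1)/2 - c e1; equating it with phi(e4,e4) gives psi(e1), and the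
   pairs (e5,e5), (e4,e5) give psi(e2), psi(e3). *)
pose w := nth 0 [:: 0; 2 *: phi (e 4%N) (e 4%N) + (2 * c) *: e 1%N;
  - 2 *: phi (e 5%N) (e 5%N) + (2 * c) *: e 2%N;
  4 *: phi (e 4%N) (e 5%N) + (2 * c) *: e 3%N; c *: e 4%N; c *: e 5%N].
have psiL := osp_lin_linear w.
have psiE : even_map (V := osp_super F) (W := osp_super F) (osp_lin w).
  have eE := @osp_homog_e F.
  apply: osp_lin_even => -[|[|[|[|[|//]]]]] _; rewrite /w /=.
  - apply: osp_homog_lin; first exact: phiE (eE 4%N) (eE 4%N).
    by apply: (@homogZ F (osp_super F)); exact: (eE 1%N).
  - apply: osp_homog_lin; first exact: phiE (eE 5%N) (eE 5%N).
    by apply: (@homogZ F (osp_super F)); exact: (eE 2%N).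
  - apply: osp_homog_lin; first exact: phiE (eE 4%N) (eE 5%N).
    by apply: (@homogZ F (osp_super F)); exact: (eE 3%N).
  - by apply: (@homogZ F (osp_super F)); exact: (eE 4%N).
  - by apply: (@homogZ F (osp_super F)); exact: (eE 5%N).
have psiZ a v : osp_lin w (a *: v) = a *: osp_lin w v :=
  scalable_linear psiL a v.
have psiN v : osp_lin w (- v) = - osp_lin w v := linearN_of psiL v.
exists (osp_lin w); split=> // x y; apply/eqP; rewrite -subr_eq0; apply/eqP.
(* It suffices that the difference cocycle is normalised, which leaves four values to compute. *)
have := super_cocycleB phiC (@coboundary_cocycle _ (osp12 F) _ psiL psiE).
move=> /osp_cocycle_eq0; apply; rewrite /coboundary [bracket _]/=.
all: rewrite !osp_lin_e // /w /= ?osp_bracket_e // /osp_basis_bracket /=.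
all: rewrite !(psiZ, psiN, osp_lin_e) // /w /= !(bZr, bZl, bDl).
all: rewrite !osp_bracket_e //.
all: rewrite /osp_basis_bracket /=.
- by apply/rowP => k; rewrite /e !mxE; field.
- by apply/rowP => k; rewrite /e !mxE; field.
- by apply/rowP => k; rewrite /e !mxE; field.
(* The coboundary at (e1,e5) is 2c e4 - 2 [phi(e4,e4), e5]; the choice of [c] equates its
   e4-coordinate with that of phi(e1,e5). *)
- by rewrite !mxE inordK //= /c /e; field.
Qed.

Local Open Scope complex_scope.

Theorem theorem3p2p1 (R : realType)
    (phi : nat -> osp12 R[i] -> osp12 R[i] -> osp12 R[i]) :
  metric_deformation phi -> trivial_deformation phi.
Proof.
move=> [phiD _]; apply: deformation_trivial phiD.
exact: osp_cocycles_are_coboundaries.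
Qed.
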